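(* Let $G,H,K$ be Hilbert spaces and let $w\colon G\to H$ and $v\colon H\to K$ be partial isometries. Then the following are equivalent: (1) $vw$ is a partial isometry. (2) $v^*vww^*$ is an idempotent. (3) $v^*vww^*$ is a projection. (4) The projections $v^*v$ and $ww^*$ commute.
   Context: Hilbert spaces are complex and operators are bounded and linear. An operator $p$ on a Hilbert space is a projection if $p^*p=p$ (equivalently, $p=p^*$ and $p^2=p$). An operator $v$ between two Hilbert spaces is a partial isometry if $vv^*v=v$ (equivalently, $v^*v$ is a projection; equivalently, $v^*$ is a partial isometry). An idempotent is an operator $e$ with $e^2=e$. *)

(* Defs.v *)
From HB Require Import structures.
From mathcomp Require Import all_boot all_order all_algebra.
From mathcomp Require Import complex ring lra.
From mathcomp Require Import boolp classical_sets filter reals topology.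
From mathcomp Require Import normedtype sequences.

Set Implicit Arguments.
Unset Strict Implicit.
Unset Printing Implicit Defensive.

Import Order.TTheory GRing.Theory Num.Theory.
Import numFieldNormedType.Exports.

Local Open Scope classical_set_scope.
Local Open Scope ring_scope.
Local Open Scope complex_scope.

(* The inner product is linear in its first argument and conjugate-linear in
   its second one. *)
HB.mixin Record isHilbert (R : realType) V of CompleteNormedModule R[i] V := {
  dotp : {dot V for (@Num.conj R[i])} ;
  dotp_norm : forall x : V, `|x| ^+ 2 = dotp x x
}.

#[short(type="hilbertType")]
HB.structure Definition Hilbert (R : realType) :=
  {V of CompleteNormedModule R[i] V & isHilbert R V}.

Section RealPart.
Context {R : realType} {V : hilbertType R}.
Implicit Types x y h : V.

Let nrm x : R := complex.Re `|x|.
Let rdot x y : R := complex.Re (dotp x y).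

Lemma Re_norm x : `|x| = (nrm x)%:C.
Proof. by rewrite /nrm RRe_real// normr_real. Qed.

Lemma Re_norm_ge0 x : 0 <= nrm x.
Proof. by rewrite -lecR -Re_norm normr_ge0. Qed.

Lemma Re_norm_sqr x : nrm x ^+ 2 = rdot x x.
Proof.
apply: complexI; rewrite rmorphXn/= -Re_norm dotp_norm /rdot RRe_real//.
by rewrite -dotp_norm rpredX// normr_real.
Qed.

Lemma Re_dotpC x y : rdot x y = rdot y x.
Proof. by rewrite /rdot hermC expr0 mul1r /=; case: (dotp y x). Qed.

Lemma Re_dotpDl x y h : rdot (x + y) h = rdot x h + rdot y h.
Proof. by rewrite /rdot linearDl raddfD. Qed.

Lemma Re_dotpDr x y h : rdot h (x + y) = rdot h x + rdot h y.
Proof. by rewrite Re_dotpC Re_dotpDl !(Re_dotpC h). Qed.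

Lemma Re_dotpZl (t : R) x y : rdot (t%:C *: x) y = t * rdot x y.
Proof.
have ReM (c : R[i]) : complex.Re (t%:C * c) = t * complex.Re c.
  by case: c => a b /=; rewrite mul0r subr0.
by rewrite /rdot linearZl_LR ReM.
Qed.

Lemma Re_dotpZr (t : R) x y : rdot x (t%:C *: y) = t * rdot x y.
Proof. by rewrite Re_dotpC Re_dotpZl Re_dotpC. Qed.

Lemma Re_dotpNr x y : rdot x (- y) = - rdot x y.
Proof. by have := Re_dotpZr (-1) x y; rewrite rmorphN1 scaleN1r mulN1r. Qed.

Lemma Re_dotpNl x y : rdot (- x) y = - rdot x y.
Proof. by rewrite Re_dotpC Re_dotpNr Re_dotpC. Qed.

Lemma Re_dotp_le x y : rdot x y <= nrm x * nrm y.
Proof.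
have := ler_normD x y; rewrite !Re_norm -rmorphD/= lecR => le1.
have : nrm (x + y) ^+ 2 <= (nrm x + nrm y) ^+ 2.
  by rewrite ler_sqr ?nnegrE ?addr_ge0 ?Re_norm_ge0.
rewrite sqrrD !Re_norm_sqr Re_dotpDl !Re_dotpDr (Re_dotpC y x); lra.
Qed.

Lemma Re_dotp_abs_le x y : `|rdot x y| <= nrm x * nrm y.
Proof.
rewrite ler_norml Re_dotp_le andbT lerNl -Re_dotpNr.
by apply: le_trans (Re_dotp_le _ _) _; rewrite /nrm normrN.
Qed.

(* The representing vector is the minimiser of J, obtained as the limit of a
   minimising sequence, which is Cauchy by the parallelogram identity. *)
Lemma Riesz_real (phi : V -> R) (M : R) :
    (forall x y, phi (x + y) = phi x + phi y) ->
    (forall (t : R) x, phi (t%:C *: x) = t * phi x) ->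
    (forall x, phi x <= M * nrm x) ->
  exists z, forall x, phi x = rdot x z.
Proof.
move=> phiD phiZ phiM.
pose J x := nrm x ^+ 2 - 2 * phi x.
have J_ge x : - M ^+ 2 <= J x.
  by have := phiM x; have := sqr_ge0 (nrm x - M); rewrite /J sqrrB; nra.
pose m := inf (range J).
have infJ : has_inf (range J).
  by split; [exists (J 0), 0 | exists (- M ^+ 2) => _ [x _ <-]].
have J_gem x : m <= J x by apply: ge_inf; [exact: infJ.2 | exists x].
pose s n : R := n.+1%:R^-1.
have s0 n : 0 < s n by rewrite invr_gt0 ltr0n.
have exu n : exists x, J x < m + s n ^+ 2.
  have [|_ [x _ <-] ltx] := @inf_adherent _ _ (s n ^+ 2) _ infJ.
    by rewrite exprn_gt0.
  by exists x.
pose u n := projT1 (cid (exu n)).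
have uP n : J (u n) < m + s n ^+ 2 by rewrite /u; case: cid.
have s_cvg (e : R) : 0 < e -> \forall n \near \oo, s n < e.
  move=> e0; have /cvgrPdist_lt/(_ e e0) := @cvg_harmonic R.
  apply: filterS => n; rewrite sub0r normrN ger0_norm//.
  by rewrite invr_ge0 ler0n.
have JD x h (t : R) :
    J (x + t%:C *: h) =
    J x + t ^+ 2 * nrm h ^+ 2 + 2 * t * (rdot h x - phi h).
  rewrite /J !Re_norm_sqr Re_dotpDl !Re_dotpDr !Re_dotpZl !Re_dotpZr.
  by rewrite phiD phiZ (Re_dotpC x h); ring.
have near_crit n h : `|rdot h (u n) - phi h| <= nrm h * s n.
  set d := _ - _.
  have quad t : 0 <= t ^+ 2 * nrm h ^+ 2 + 2 * t * d + s n ^+ 2.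
    by have := J_gem (u n + t%:C *: h); have := uP n; rewrite JD -/d; lra.
  have [h0|hN0] := eqVneq (nrm h) 0.
    have hE0 : h = 0 by apply/eqP; rewrite -normr_eq0 Re_norm h0.
    have r0 y : rdot 0 y = 0.
      by have := Re_dotpZl 0 0 y; rewrite scaler0 mul0r.
    have p0 : phi 0 = 0 by have := phiZ 0 0; rewrite scaler0 mul0r.
    by rewrite h0 mul0r /d hE0 r0 p0 subr0 normr0.
  have hp : 0 < nrm h by rewrite lt_def hN0 Re_norm_ge0.
  rewrite -ler_sqr ?nnegrE// ?mulr_ge0// ?(ltW (s0 _)) ?Re_norm_ge0//.
  rewrite real_normK ?num_real// exprMn.
  have := quad (- d / nrm h ^+ 2).
  have -> : (- d / nrm h ^+ 2) ^+ 2 * nrm h ^+ 2 +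
     2 * (- d / nrm h ^+ 2) * d + s n ^+ 2 = s n ^+ 2 - d ^+ 2 / nrm h ^+ 2.
    by field.
  by rewrite subr_ge0 ler_pdivrMr ?exprn_gt0// mulrC.
have u_dist p q : nrm (u p - u q) <= 2 * (s p + s q).
  have := J_gem (u p + 2^-1%:C *: (u q - u p)); have := uP p; have := uP q.
  have := s0 p; have := s0 q; rewrite JD.
  have -> : phi (u q - u p) = phi (u q) - phi (u p).
    by have := phiZ (-1) (u p); rewrite rmorphN1 scaleN1r mulN1r phiD => ->.
  move=> sq sp Jq Jp Jm.
  rewrite -ler_sqr ?nnegrE ?Re_norm_ge0//; last first.
    by rewrite mulr_ge0// addr_ge0// ltW.
  move: Jq Jp Jm.
  rewrite /J !Re_norm_sqr !(Re_dotpDl, Re_dotpDr, Re_dotpNl, Re_dotpNr).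
  rewrite (Re_dotpC (u q) (u p)); nra.
have /cauchy_cvg/cvg_ex[z /cvgrPdist_lt uz] : cauchy (u @ \oo).
  apply: cauchy_exP => e e0.
  have eE : e = (complex.Re e)%:C by rewrite RRe_real// gtr0_real.
  have re0 : 0 < complex.Re e by rewrite -ltcR -eE.
  have e40 : 0 < complex.Re e / 4 by rewrite divr_gt0.
  have sE := s_cvg _ e40.
  have [N _ sN] := sE.
  exists (u N).
  suff : \forall n \near \oo, ball (u N) e (u n) by [].
  near=> n.
  rewrite -ball_normE/= eE Re_norm ltcR.
  have sn : s n < complex.Re e / 4 by near: n.
  by have := u_dist N n; have := sN N (leqnn N); rewrite /=; lra.
exists z => h; apply/esym/eqP; rewrite -subr_eq0; apply: contraT => D0.
set D := rdot h z - phi h in D0.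
have h1 : 0 < nrm h + 1 by rewrite ltr_wpDl ?Re_norm_ge0.
pose e := `|D| / (2 * (nrm h + 1)).
have e0 : 0 < e by rewrite divr_gt0 ?normr_gt0// mulr_gt0.
have eC0 : 0 < e%:C by rewrite ltcR.
have sE := s_cvg _ e0; have uE := uz _ eC0.
near \oo => n.
have sn : s n < e by near: n.
have un : nrm (z - u n) < e.
  by rewrite -ltcR -Re_norm; near: n.
have DE : D = rdot h (z - u n) + (rdot h (u n) - phi h).
  by rewrite /D Re_dotpDr Re_dotpNr; ring.
have : `|D| <= nrm h * e + nrm h * e.
  rewrite DE; apply: le_trans (ler_normD _ _) _; apply: lerD.
    apply: le_trans (Re_dotp_abs_le _ _) _.
    by rewrite ler_wpM2l ?Re_norm_ge0 ?ltW.
  apply: le_trans (near_crit _ _) _.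
  by rewrite ler_wpM2l ?Re_norm_ge0 ?ltW.
have : `|D| = e * (2 * (nrm h + 1)) by rewrite /e divfK// gt_eqF// mulr_gt0.
by nra.
Unshelve. all: by end_near. Qed.

End RealPart.

Lemma Riesz (R : realType) (V : hilbertType R) (f : {scalar V}) (M : R[i]) :
  (forall x, `|f x| <= M * `|x|) -> exists z, forall x, f x = dotp x z.
Proof.
move=> fM; have ReZ (t : R) (c : R[i]) : complex.Re (t%:C * c) = t * complex.Re c.
  by case: c => a b /=; rewrite mul0r subr0.
have [||x|z zP] := @Riesz_real R V (fun x => complex.Re (f x)) (complex.Re M).
- by move=> x y; rewrite linearD raddfD.
- by move=> t x; rewrite linearZ; exact: ReZ.
- have := fM x; rewrite (Re_norm x) lecE => /andP[_].
  rewrite [M * _]mulrC ReZ mulrC; apply: le_trans.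
  rewrite -lecR (RRe_real (normr_real (f x))).
  by apply: le_trans (normc_ge_Re _); rewrite lecR ler_norm.
exists z => x; apply/eqP; rewrite eq_complex zP eqxx /=.
have := zP ('i *: x); rewrite linearZ linearZl_LR.
have ReiM (c : R[i]) : complex.Re ('i * c) = - complex.Im c.
  by case: c => a b /=; rewrite mul0r mul1r sub0r.
by move=> E; apply/eqP/oppr_inj; rewrite -!ReiM; exact: E.
Qed.

Lemma dotp_le (R : realType) (V : hilbertType R) (x y : V) :
  `|dotp x y| <= `|x| * `|y|.
Proof.
set c := dotp x y; have [->|c0] := eqVneq c 0; first by rewrite normr0 mulr_ge0.
have cE : dotp x (c *: y) = `|c| ^+ 2 by rewrite linearZr_LR normCKC.
have : (complex.Re (dotp x (c *: y)))%:C <= `|x| * `|c *: y|.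
  rewrite -[`|x|](RRe_real (normr_real x)) -[`|c *: y|](RRe_real (normr_real _)).
  by rewrite -rmorphM/= lecR Re_dotp_le.
rewrite cE RRe_real ?rpredX ?normr_real// normrZ mulrCA expr2.
by rewrite ler_pM2l ?normr_gt0.
Qed.

Lemma dotp_inj (R : realType) (V : hilbertType R) (y z : V) :
  (forall x, dotp x y = dotp x z) -> y = z.
Proof.
move=> yz; apply/eqP; rewrite -subr_eq0 -(dnorm_eq0 dotp).
by rewrite linearBr subr_eq0; apply/eqP; exact: yz.
Qed.

Section BoundedOperators.
Context {R : realType}.

Record boundedOp (G H : hilbertType R) := BoundedOp {
  op_lin :> {linear G -> H};
  op_bounded : exists M : R[i], forall x, `|op_lin x| <= M * `|x|
}.

Lemma boundedOpP (G H : hilbertType R) (f g : boundedOp G H) :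
  f =1 g -> f = g.
Proof.
case: f g => [f Bf] [g Bg] /= fg.
have E : f = g.
  case: f g fg {Bf Bg} => f [[cf] [df]] [g [[cg] [dg]]] /= /funext fg.
  rewrite -{}fg in cg dg *.
  by rewrite (Prop_irrelevance cg cf) (Prop_irrelevance dg df).
by rewrite -{}E in Bg *; congr BoundedOp; exact: Prop_irrelevance.
Qed.

Lemma op_bounded_ge0 (G H : hilbertType R) (v : boundedOp G H) :
  exists2 M : R[i], 0 <= M & forall x, `|v x| <= M * `|x|.
Proof.
have [M vM] := op_bounded v; exists `|M| => // x.
rewrite -[`|x|]normr_id -normrM ger0_norm ?vM//.
by apply: le_trans (vM x).
Qed.

Fact op_comp_bounded (G H K : hilbertType R) (v : boundedOp H K)
    (w : boundedOp G H) :
  exists M : R[i], forall x, `|(v \o w) x| <= M * `|x|.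
Proof.
have [Mv Mv0 vP] := op_bounded_ge0 v; have [Mw wP] := op_bounded w.
exists (Mv * Mw) => x /=; apply: le_trans (vP _) _.
by rewrite -mulrA ler_wpM2l.
Qed.

Definition op_comp (G H K : hilbertType R) (v : boundedOp H K)
    (w : boundedOp G H) : boundedOp G K :=
  BoundedOp (op_comp_bounded v w).

Definition is_adjoint (G H : hilbertType R) (v : boundedOp G H)
    (v' : boundedOp H G) : Prop :=
  forall x y, dotp (v x) y = dotp x (v' y).

Lemma op_adj_exists (G H : hilbertType R) (v : boundedOp G H) :
  exists v' : boundedOp H G, is_adjoint v v'.
Proof.
have [M M0 vM] := op_bounded_ge0 v.
have ex y : exists z, forall x, dotp (v x) y = dotp x z.
  have vyM x : `|dotp (v x) y| <= M * `|y| * `|x|.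
    by apply: le_trans (dotp_le _ _) _; rewrite mulrAC ler_wpM2r.
  have lin : scalar (fun x => dotp (v x) y).
    by move=> a x x'; rewrite linearP linearPl.
  pose lf := GRing.isLinear.Build _ _ _ _ (fun x => dotp (v x) y) lin.
  pose f : {scalar G} := HB.pack (fun x => dotp (v x) y) lf.
  exact: (@Riesz _ _ f _ vyM).
pose u y := projT1 (cid (ex y)).
have uP x y : dotp (v x) y = dotp x (u y) by rewrite /u; case: cid.
have ulin : linear u.
  move=> a y y'; apply: dotp_inj => x.
  by rewrite -uP !linearPr; congr (_ * _ + _); exact: uP.
pose lu := GRing.isLinear.Build _ _ _ _ u ulin.
pose U : {linear H -> G} := HB.pack u lu.
have Ubd : exists M : R[i], forall y, `|U y| <= M * `|y|.
  exists M => y; rewrite -[U y]/(u y).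
  have [->|u0] := eqVneq (u y) 0.
    by rewrite normr0 mulr_ge0.
  have : `|u y| ^+ 2 <= `|u y| * (M * `|y|).
    rewrite dotp_norm -uP -[X in X <= _]ger0_norm; last first.
      by rewrite uP -dotp_norm exprn_ge0.
    apply: le_trans (dotp_le _ _) _.
    by rewrite mulrA [_ * M]mulrC ler_wpM2r.
  by rewrite expr2 ler_pM2l ?normr_gt0.
by exists (BoundedOp Ubd).
Qed.

Lemma op_adj_unique (G H : hilbertType R) (v : boundedOp G H)
    (v1 v2 : boundedOp H G) : is_adjoint v v1 -> is_adjoint v v2 -> v1 = v2.
Proof.
move=> a1 a2; apply: boundedOpP => y; apply: dotp_inj => x.
by rewrite -a1 a2.
Qed.

Definition op_adj (G H : hilbertType R) (v : boundedOp G H) :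
  boundedOp H G := projT1 (cid (op_adj_exists v)).

Lemma op_adjP (G H : hilbertType R) (v : boundedOp G H) x y :
  dotp (v x) y = dotp x (op_adj v y).
Proof. by rewrite /op_adj; case: cid. Qed.

End BoundedOperators.

Declare Scope op_scope.
Delimit Scope op_scope with op.
Bind Scope op_scope with boundedOp.
Notation "v * w" := (op_comp v w) : op_scope.
Notation "v ^*" := (op_adj v) : op_scope.
Local Open Scope op_scope.

Definition is_idempotent (R : realType) (H : hilbertType R)
  (e : boundedOp H H) : Prop := e * e = e.

Definition is_projection (R : realType) (H : hilbertType R)
  (p : boundedOp H H) : Prop := p^* * p = p.

Definition partial_isometry (R : realType) (G H : hilbertType R)
  (v : boundedOp G H) : Prop := v * v^* * v = v.

(* Main.v *)
Require Import Defs.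
From mathcomp Require Import all_boot reals.
From mathcomp Require Import ssralg sesquilinear complex.

Set Implicit Arguments.
Unset Strict Implicit.

(**
Write p = v^* v and q = w w^*. The one step that is not pure algebra is that an
idempotent product pq of projections is a projection. If pqpq = pq then the
four products a^* a, a^* b, b^* a, b^* b of a = qp and b = pqp all equal pqp,
so (a - b)^* (a - b) = 0 and a = b. Hence qp = pqp is self-adjoint, that is,
p and q commute.
*)

Section BoundedOperatorAlgebra.
Context {R : realType}.
Local Open Scope op_scope.

Lemma op_compA (F G H K : hilbertType R) (u : boundedOp H K)
    (v : boundedOp G H) (w : boundedOp F G) : u * (v * w) = u * v * w.
Proof. exact: boundedOpP. Qed.

(** [op_adj] comes from a choice, so its identities are obtained by exhibiting a candidate and
    invoking uniqueness of adjoints. *)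
Lemma op_adj_eq (G H : hilbertType R) (v : boundedOp G H)
    (v' : boundedOp H G) : is_adjoint v v' -> v^* = v'.
Proof. exact/op_adj_unique/op_adjP. Qed.

Lemma op_adjK (G H : hilbertType R) (v : boundedOp G H) : v^*^* = v.
Proof.
by apply: op_adj_eq => x y; rewrite hermC [RHS]hermC /= op_adjP.
Qed.

Lemma op_adjM (G H K : hilbertType R) (v : boundedOp H K)
    (w : boundedOp G H) : (v * w)^* = w^* * v^*.
Proof. by apply: op_adj_eq => x y; rewrite /= !op_adjP. Qed.

(** The squared norm of [a x - b x] expands into four inner products, each equal to
    [dotp x ((a^* * a) x)] up to sign, and these cancel. *)
Lemma eq_op_of_adjM (G H : hilbertType R) (a b : boundedOp G H) :
    a^* * b = a^* * a -> b^* * a = a^* * a -> b^* * b = a^* * a -> a = b.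
Proof.
have dotE (c d : boundedOp G H) x :
    dotp (c x) (d x) = dotp x ((c^* * d) x) by rewrite op_adjP.
move=> ab ba bb; apply: boundedOpP => x.
apply/eqP; rewrite -GRing.subr_eq0 -(dnorm_eq0 dotp).
by rewrite linearBl !linearBr /= !dotE ab ba bb !GRing.subrr.
Qed.

Section Projections.
Context {H : hilbertType R}.
Implicit Types p q e : boundedOp H H.

Lemma projection_adj p : is_projection p -> p^* = p.
Proof. by rewrite /is_projection => pP; rewrite -pP op_adjM op_adjK. Qed.

Lemma projection_idem p : is_projection p -> p * p = p.
Proof. by move=> pP; rewrite -{1}(projection_adj pP). Qed.

Lemma projection_adjM_comm p q :
  is_projection p -> is_projection q -> (p * q)^* = p * q -> p * q = q * p.
Proof.
by move=> pP qP <-; rewrite op_adjM (projection_adj pP) (projection_adj qP).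
Qed.

Lemma projectionM_comm p q : is_projection p -> is_projection q ->
  p * q = q * p -> is_projection (p * q).
Proof.
move=> pP qP pq; rewrite /is_projection op_adjM.
rewrite (projection_adj pP) (projection_adj qP) -pq op_compA -(op_compA p q p).
by rewrite -pq op_compA (projection_idem pP) -op_compA (projection_idem qP).
Qed.

Lemma idempotentM_comm p q : is_projection p -> is_projection q ->
  is_idempotent (p * q) -> p * q = q * p.
Proof.
move=> pP qP; rewrite /is_idempotent op_compA => pqpq.
have [pA qA] := (projection_adj pP, projection_adj qP).
have [pI qI] := (projection_idem pP, projection_idem qP).
(* Products are normalised to the left, so a repeated factor occurs behind a prefix [u]. *)
have mulpp (u : boundedOp H H) : u * p * p = u * p by rewrite -op_compA pI.
have mulqq (u : boundedOp H H) : u * q * q = u * q by rewrite -op_compA qI.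
have qp : q * p = p * q * p.
  by apply: eq_op_of_adjM; rewrite !op_adjM pA qA !op_compA;
    rewrite ?(mulpp, mulqq) ?pqpq.
(* Taking adjoints in [qp] gives pq = pqp, and pqp is qp. *)
by have := congr1 (@op_adj _ _ _) qp; rewrite !op_adjM pA qA op_compA -qp.
Qed.

End Projections.

Lemma partial_isometry_adjM (G H : hilbertType R) (v : boundedOp G H) :
  partial_isometry v -> is_projection (v^* * v).
Proof.
rewrite /partial_isometry /is_projection => vP.
by rewrite op_adjM op_adjK -op_compA (op_compA v) vP.
Qed.

Lemma partial_isometry_Madj (G H : hilbertType R) (v : boundedOp G H) :
  partial_isometry v -> is_projection (v * v^*).
Proof.
rewrite /partial_isometry /is_projection => vP.
by rewrite op_adjM op_adjK op_compA vP.
Qed.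

End BoundedOperatorAlgebra.

Theorem lemma2p1 (R : realType) (G H K : hilbertType R)
    (w : boundedOp G H) (v : boundedOp H K) :
  partial_isometry w -> partial_isometry v ->
  [<-> partial_isometry (v * w);
       is_idempotent (v^* * v * w * w^*);
       is_projection (v^* * v * w * w^*);
       ((v^* * v) * (w * w^*) = (w * w^*) * (v^* * v))%op].
Proof.
move=> wP vP.
have pP := partial_isometry_adjM vP.
have qP := partial_isometry_Madj wP.
tfae.
- rewrite /partial_isometry /is_idempotent op_adjM !op_compA => vwP.
  (* Flanking vw(vw)^*vw = vw by v^* and w^* turns it into pqpq = pq. *)
  have := f_equal (fun u => v^* * u * w^*)%op vwP.
  by rewrite !op_compA.
(* The passage from (2) to (3) goes through commutation of p and q. *)
- rewrite -op_compA => idem.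
  by apply: projectionM_comm => //; exact: idempotentM_comm.
- rewrite -op_compA => /projection_adj.
  exact: projection_adjM_comm.
- move=> comm; rewrite /partial_isometry op_adjM.
  (* Regrouping exposes qp between v and w; once it is replaced by pq, the identities vp = v and qw
     = w leave vw. *)
  have -> : (v * w * (w^* * v^*) * (v * w) =
      v * ((w * w^*) * (v^* * v)) * w)%op by rewrite !op_compA.
  by rewrite -comm !op_compA vP -2!op_compA (op_compA w) wP.
Qed.
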